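(* Let $V_1,V_2,N_1,N_2:[0,\infty)\times\mathbb{R}^n\to[0,\infty)$, let $L:[0,\infty)\to[0,\infty)$ be locally essentially bounded, and let $\rho_1,\rho_2\in L^1_{\mathrm{loc}}([0,\infty))$ be nonnegative. Assume that along every solution $x(\cdot)$ of $\dot x(t)=f(t,x(t))$ on $[t_0,\infty)$, for a.e. $t\ge t_0$, $$\frac{d}{dt}V_1(t,x(t))\le -N_1(t,x(t))+L(t)V_2(t,x(t))+\rho_1(t),\qquad \frac{d}{dt}V_2(t,x(t))\le -N_2(t,x(t))+\rho_2(t).$$ Let $L^*\ge 0$ satisfy $L(t)\le L^*$ for a.e. $t\ge t_0$, and assume that for some $\mu>0$, along every solution, $N_2(t,x(t))\ge \mu V_2(t,x(t))$ for a.e. $t\ge t_0$. Choose $\delta>L^*/\mu$ with $\delta>0$ and set $W(t,x):=V_1(t,x)+\delta V_2(t,x)$. Then along every solution, for a.e. $t\ge t_0$, $$\frac{d}{dt}W(t,x(t))\le -N_1(t,x(t))-\Big(\delta-\frac{L^*}{\mu}\Big)N_2(t,x(t))+\rho_1(t)+\delta\rho_2(t).$$ Consequently, with $\gamma:=\min\{1,\delta-L^*/\mu\}$, $\Phi:=N_1+N_2$ and $\rho:=\rho_1+\delta\rho_2$, along every solution and for a.e. $t\ge t_0$, $$\frac{d}{dt}W(t,x(t))\le -\gamma\,\Phi(t,x(t))+\rho(t).$$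
   Context: Fix $t_0\ge 0$ and $f:[t_0,\infty)\times\mathbb{R}^n\to\mathbb{R}^n$ such that $t\mapsto f(t,x)$ is measurable for every $x$ and $x\mapsto f(t,x)$ is locally Lipschitz for a.e. $t\ge t_0$. A solution is a locally absolutely continuous $x:[t_0,\infty)\to\mathbb{R}^n$ with $\dot x(t)=f(t,x(t))$ for a.e. $t\ge t_0$ (only solutions defined on all of $[t_0,\infty)$ are considered). Standing assumption: for every solution $x(\cdot)$ the maps $t\mapsto V_i(t,x(t))$, $i=1,2$, are locally absolutely continuous on $[t_0,\infty)$. *)

(* Defs.v *)
From HB Require Import structures.
From mathcomp Require Import all_boot all_order all_algebra.
From mathcomp Require Import all_classical all_reals all_analysis.
Import Order.TTheory GRing.Theory Num.Theory.
Import numFieldNormedType.Exports.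

Set Implicit Arguments.
Unset Strict Implicit.
Unset Printing Implicit Defensive.

Local Open Scope classical_set_scope.
Local Open Scope ring_scope.

(* Measurability is Lebesgue measurability (with respect to the completed
   sigma-algebra), which is weaker than Borel measurability, the meaning that
   [measurable_fun] has on [R] itself. *)
Definition lebesgue_measurable_fun (R : realType) (D : set R) (g : R -> R) :=
  @measurable_fun _ _
    (caratheodory_type (lebesgue_stieltjes_measure (@idfun R))^*%mu) _ D g.

Definition rv_lebesgue_measurable_fun (R : realType) (n : nat) (D : set R)
    (g : R -> 'rV[R]_n) :=
  forall i : 'I_n, lebesgue_measurable_fun D (fun t => g t ord0 i).

(* The library's [locally_integrable] requires an open domain; here the domain
   is [0, oo[. *)
Definition locally_integrable_ge0 (R : realType) (g : R -> R) :=
  forall T : R, 0 <= T ->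
    (@completed_lebesgue_measure R).-integrable `[0, T] (EFin \o g).

Definition locally_ess_bounded_ge0 (R : realType) (g : R -> R) :=
  lebesgue_measurable_fun `[0, +oo[ g /\
  forall T : R, 0 <= T -> exists M : R,
    {ae @lebesgue_measure R, forall t, 0 <= t <= T -> `|g t| <= M}.

Definition abs_continuous_on (R : realType) (V : normedModType R) (a b : R)
    (g : R -> V) :=
  forall e : R, 0 < e -> exists2 d : R, 0 < d &
    forall (N : nat) (u v : 'I_N -> R),
      (forall i, [/\ a <= u i, u i <= v i & v i <= b]) ->
      trivIset setT (fun i => `]u i, v i[%classic) ->
      \sum_(i < N) (v i - u i) < d ->
      \sum_(i < N) `|g (v i) - g (u i)| < e.

Definition locally_abs_continuous (R : realType) (V : normedModType R) (t0 : R)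
    (g : R -> V) :=
  forall T : R, t0 <= T -> abs_continuous_on t0 T g.

Definition solution (R : realType) (n : nat) (f : R -> 'rV[R]_n -> 'rV[R]_n)
    (t0 : R) (x : R -> 'rV[R]_n) :=
  locally_abs_continuous t0 x /\
  {ae @lebesgue_measure R, forall t, t0 <= t -> is_derive t 1 x (f t (x t))}.

(* "dg/dt <= h a.e. on [t0, oo[" includes that dg/dt exists a.e.: [derive1 g t]
   has a default value where [g] is not differentiable. *)
Definition ae_derivative_le (R : realType) (t0 : R) (g h : R -> R) :=
  {ae @lebesgue_measure R,
    forall t, t0 <= t -> derivable g t 1 /\ derive1 g t <= h t}.

(* Main.v *)
(* Since [V2 <= N2 / mu], the cross term [L * V2] in the bound for [V1] is at most
   [Lstar / mu * N2], which the dissipation [- delta * N2] of [delta * V2]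
   absorbs because [delta > Lstar / mu]. *)
Require Import Defs.
From HB Require Import structures.
From mathcomp Require Import all_boot all_order all_algebra.
From mathcomp Require Import all_classical all_reals all_analysis.
From mathcomp Require Import lra.
Import Order.TTheory GRing.Theory Num.Theory.
Import numFieldNormedType.Exports.
Local Open Scope classical_set_scope.
Local Open Scope ring_scope.

(* The library's instance is not found by unification at [lebesgue_measure],
   whose carrier is presented as a semiring of sets only. *)
#[local] Instance ae_lebesgue_filter (R : realType) :
  Filter (nbhs (almost_everywhere (@lebesgue_measure R))).
Proof. exact: (ae_filter_ringOfSetsType (@lebesgue_measure R)). Qed.

Lemma ae_derivative_leW {R : realType} {t0 : R} {g h k : R -> R} :
  (forall t, t0 <= t -> h t <= k t) ->
  ae_derivative_le t0 g h -> ae_derivative_le t0 g k.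
Proof.
move=> hk; apply: filterS => t + t0t => /(_ t0t)[dg gh].
by split=> //; exact: le_trans gh (hk t t0t).
Qed.

(** Off the union of the two exceptional null sets both derivatives exist, so the sum rule applies,
    and [0 <= c] keeps the direction of the second bound. With [c = delta] this differentiates [W]
    along a solution. *)
Lemma ae_derivative_leDZ {R : realType} {t0 c : R} {g1 g2 h1 h2 : R -> R} :
  0 <= c -> ae_derivative_le t0 g1 h1 -> ae_derivative_le t0 g2 h2 ->
  ae_derivative_le t0 (fun t => g1 t + c * g2 t) (fun t => h1 t + c * h2 t).
Proof.
move=> c0; apply: filterS2 => t + + t0t => /(_ t0t)[d1 le1] /(_ t0t)[d2 le2].
(* The form [c *: g2] fits the derivative rules and is convertible to [fun t => c * g2 t], as
   scaling on [R] is multiplication. *)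
have d2c : derivable (c *: g2) t 1 by exact: derivableZ.
split; first exact: (derivableD d1 d2c).
rewrite derive1E (deriveD d1 d2c) deriveZ// -!derive1E.
by apply: lerD => //; exact: ler_wpM2l.
Qed.

Theorem theorem3p1 (R : realType) (n : nat) (t0 : R)
  (f : R -> 'rV[R]_n -> 'rV[R]_n)
  (V1 V2 N1 N2 : R -> 'rV[R]_n -> R) (L rho1 rho2 : R -> R)
  (Lstar mu delta : R)
  (t0_ge0 : 0 <= t0)
  (f_meas : forall x, rv_lebesgue_measurable_fun `[t0, +oo[ (fun t => f t x))
  (f_lip : {ae @lebesgue_measure R, forall t, t0 <= t ->
    [locally [lipschitz (f t) x | x in setT]]})
  (V1_ac : forall x, solution f t0 x ->
    locally_abs_continuous t0 (fun t => V1 t (x t)))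
  (V2_ac : forall x, solution f t0 x ->
    locally_abs_continuous t0 (fun t => V2 t (x t)))
  (V1_ge0 : forall t x, 0 <= t -> 0 <= V1 t x)
  (V2_ge0 : forall t x, 0 <= t -> 0 <= V2 t x)
  (N1_ge0 : forall t x, 0 <= t -> 0 <= N1 t x)
  (N2_ge0 : forall t x, 0 <= t -> 0 <= N2 t x)
  (L_ge0 : forall t, 0 <= t -> 0 <= L t)
  (L_loc : locally_ess_bounded_ge0 L)
  (rho1_ge0 : forall t, 0 <= t -> 0 <= rho1 t)
  (rho2_ge0 : forall t, 0 <= t -> 0 <= rho2 t)
  (rho1_loc : locally_integrable_ge0 rho1)
  (rho2_loc : locally_integrable_ge0 rho2)
  (V1_decay : forall x, solution f t0 x ->
    ae_derivative_le t0 (fun t => V1 t (x t))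
      (fun t => - N1 t (x t) + L t * V2 t (x t) + rho1 t))
  (V2_decay : forall x, solution f t0 x ->
    ae_derivative_le t0 (fun t => V2 t (x t))
      (fun t => - N2 t (x t) + rho2 t))
  (Lstar_ge0 : 0 <= Lstar)
  (L_le : {ae @lebesgue_measure R, forall t, t0 <= t -> L t <= Lstar})
  (mu_gt0 : 0 < mu)
  (N2_ge : forall x, solution f t0 x ->
    {ae @lebesgue_measure R, forall t, t0 <= t ->
      mu * V2 t (x t) <= N2 t (x t)})
  (delta_gt : Lstar / mu < delta)
  (delta_gt0 : 0 < delta) :
  let W := fun t x => V1 t x + delta * V2 t x in
  let gamma := Num.min 1 (delta - Lstar / mu) in
  let Phi := fun t x => N1 t x + N2 t x in
  let rho := fun t => rho1 t + delta * rho2 t in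
  (forall x, solution f t0 x ->
    ae_derivative_le t0 (fun t => W t (x t))
      (fun t => - N1 t (x t) - (delta - Lstar / mu) * N2 t (x t)
                + rho1 t + delta * rho2 t)) /\
  (forall x, solution f t0 x ->
    ae_derivative_le t0 (fun t => W t (x t))
      (fun t => - gamma * Phi t (x t) + rho t)).
Proof.
move=> W gamma Phi rho.
have W_decay x : solution f t0 x -> ae_derivative_le t0 (fun t => W t (x t))
    (fun t => - N1 t (x t) - (delta - Lstar / mu) * N2 t (x t)
              + rho1 t + delta * rho2 t).
  move=> solx.
  have := ae_derivative_leDZ (ltW delta_gt0) (V1_decay x solx) (V2_decay x solx).
  (* Three null sets are discarded at once: those of the bound on [L], of [mu * V2 <= N2] along [x],
     and of the combined derivative bound. *)
  apply: filterS3 L_le (N2_ge x solx) => t LLstar muN2 + t0t.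
  move=> /(_ t0t)[dW le_dW]; split=> //; apply: le_trans le_dW _.
  have LV2 : L t * V2 t (x t) <= Lstar / mu * N2 t (x t).
    (* Replacing [L t] by [Lstar] uses [0 <= V2]; replacing [V2] by [N2 / mu] uses [0 <= Lstar]. *)
    apply: (@le_trans _ _ (Lstar * V2 t (x t))).
      by apply: ler_wpM2r (LLstar t0t); exact/V2_ge0/(le_trans t0_ge0).
    rewrite -mulrA ler_wpM2l// mulrC ler_pdivlMr// mulrC.
    exact: muN2.
  (* After expanding the products, the two bounds differ exactly by the inequality [LV2]. *)
  lra.
(* The two upper bounds compare at every [t >= t0], so no further null set arises. *)
split=> // x solx; apply: ae_derivative_leW (W_decay x solx) => t t0t.
have t_ge0 := le_trans t0_ge0 t0t.
(* Each argument of the minimum [gamma] serves one term: [1] for [N1], [delta - Lstar / mu] for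
   [N2]; nonnegativity of [N1] and [N2] lets the coefficients be lowered to [gamma]. *)
have gN1 : gamma * N1 t (x t) <= N1 t (x t).
  by rewrite ler_piMl ?N1_ge0// ge_min lexx.
have gN2 : gamma * N2 t (x t) <= (delta - Lstar / mu) * N2 t (x t).
  by rewrite ler_wpM2r ?N2_ge0// ge_min lexx orbT.
rewrite /Phi /rho; lra.
Qed.
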